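(* Let $G$ be a finite graph (loops allowed, no multiple edges) on vertex set $\{v_1,\dots,v_n\}$, and consider the synchronous dynamics described in the context, in which $v_1$ has an arbitrary update rule and every $v_i$ with $i\ge 2$ has a threshold rule with threshold $r_i$. Then there exists $T$ such that for every $t\ge T$ and every $i\in\{2,\dots,n\}$: if $v_i\in U^*_{t-1}\triangle U^*_{t+1}$, then $v_i\in N_1$ and $|N_i\cap U^*_t|=r_i-1$.
   Context: For each $i$, $N_i$ denotes the neighbourhood of $v_i$ (including $v_i$ itself iff there is a loop at $v_i$). Each vertex holds an opinion in $\{+1,-1\}$; $U_t$ is the set of vertices with opinion $+1$ at time $t$ ($t=0,1,2,\dots$), with $U_0$ arbitrary. All vertices update simultaneously: for each $i$ there is a family $\mathcal S_i$ of subsets of $N_i$ such that $v_i\in U_{t+1}$ iff $N_i\cap U_t\in\mathcal S_i$. Vertex $v_i$ has a threshold rule with (integer) threshold $r_i$ if $\mathcal S_i=\{A\subseteq N_i:|A|\ge r_i\}$. Write $U^*_t=U_t\setminus\{v_1\}$, and $\triangle$ denotes symmetric difference. *)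

(* Defs.v *)
From HB Require Import structures.
From mathcomp Require Import all_boot all_order all_algebra.

Set Implicit Arguments.
Unset Strict Implicit.
Unset Printing Implicit Defensive.

Local Open Scope ring_scope.

Section OpinionDynamics.

(* A finite graph without multiple edges is an adjacency relation [e] on a
   finite type; [symmetric e] is assumed where it is used, and [e v v] says
   that there is a loop at [v]. *)
Variables (V : finType) (e : rel V).

Definition neighbourhood (v : V) : {set V} := [set w | e v w].

Definition rule_families (S : V -> {set {set V}}) : Prop :=
  forall v A, A \in S v -> A \subset neighbourhood v.

Definition threshold_rule (S : V -> {set {set V}}) (v : V) (r : int) : Prop :=
  S v = [set A : {set V} | (A \subset neighbourhood v) && (r <= #|A|%:Z)].

Definition update (S : V -> {set {set V}}) (U : {set V}) : {set V} :=
  [set v | neighbourhood v :&: U \in S v].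

Definition positive_at (S : V -> {set {set V}}) (U0 : {set V}) (t : nat) :
  {set V} := iter t (update S) U0.

End OpinionDynamics.

Definition set_symdiff (T : finType) (A B : {set T}) : {set T} :=
  (A :\: B) :|: (B :\: A).

(* Main.v *)
Require Import Defs.
From HB Require Import structures.
From mathcomp Require Import all_boot all_order all_algebra.
From mathcomp Require Import zify.

Import Order.TTheory GRing.Theory Num.Theory.

Local Open Scope ring_scope.

(** Goles–Olivos energy argument on the vertices other than [v1]. Let [A], [B],
    [C] be three consecutive states with [v1] removed, and put
    [c v = 2 (r v) - 1 - [v ~ v1]]. The energy
    [\sum_(v in A) c v + \sum_(v in B) c v - 2 #{(v, w) in A x B | v ~ w}] is
    symmetric in [A] and [B], so it drops in one step by
    [\sum_v ([v in A] - [v in C]) (c v - 2 |N_v :&: B|)]. Depending on the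
    opinion of [v1], a neighbour [v] of [v1] has effective threshold [r v] or
    [r v - 1] on [B]; the shift in [c v] makes its term nonnegative in both
    cases, and zero only if [v] does not change or [|N_v :&: B| = r v - 1]. The
    orbit being finite, the energy is eventually constant, and from then on
    every term vanishes; for [v] not adjacent to [v1], [c v] is odd, so [v]
    does not change. *)

(** The orbit enters a cycle, where every state recurs, so a decrease of [E] there could never be
    made up. *)
Lemma noninc_iter_eventually_const (X : finType) (f : X -> X) (E : X -> int)
    (x0 : X) :
  (forall x, E (f x) <= E x) ->
  exists T : nat, forall t : nat, (T <= t)%N ->
    E (iter t.+1 f x0) = E (iter t f x0).
Proof.
move=> Ef.
have mono s k : E (iter (s + k) f x0) <= E (iter s f x0).
  by elim: k => [|k IHk]; rewrite ?addn0 // addnS (le_trans (Ef _)).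
have /trajectP[m lt_mn eq_mn] := looping_order f x0.
set n := fingraph.order f x0 in lt_mn eq_mn.
exists m => t le_mt; apply/eqP; rewrite eq_le Ef andTb.
have -> : iter t f x0 = iter (t.+1 + (n - m).-1) f x0.
  rewrite (_ : (t.+1 + _)%N = (t - m) + n)%N; last by lia.
  by rewrite iterD eq_mn -iterD subnK.
exact: mono.
Qed.

Section Energy.

Variables (V : finType) (e : rel V) (e_sym : symmetric e) (v1 : V).
Variables (S : V -> {set {set V}}) (r : V -> int).
Hypothesis S_thr : forall v : V, v != v1 -> threshold_rule e S v (r v).

Definition cost (v : V) : int := r v *+ 2 - 1 - (e v v1)%:Z.

Definition gap (B : {set V}) (v : V) : int :=
  cost v - #|neighbourhood e v :&: B|%:Z *+ 2.

Definition pair_energy (A B : {set V}) : int :=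
  \sum_(v in A) cost v + \sum_(v in B) gap A v.

Definition energy (U : {set V}) : int := pair_energy (U :\ v1) (update e S U :\ v1).

(** Double counting of the adjacent pairs in [A] x [B]. *)
Lemma sum_neighbourhoodC (A B : {set V}) :
  (\sum_(v in A) #|neighbourhood e v :&: B| =
   \sum_(v in B) #|neighbourhood e v :&: A|)%N.
Proof.
have cardE C v : #|neighbourhood e v :&: C| = (\sum_(w in C) e v w)%N.
  rewrite -sum1_card big_mkcond [RHS]big_mkcond /=.
  by apply: eq_bigr => w _; rewrite !inE; case: (e v w); case: (w \in C).
under eq_bigr do rewrite cardE.
under [RHS]eq_bigr do rewrite cardE.
rewrite exchange_big; apply: eq_bigr => v _.
by apply: eq_bigr => w _; rewrite e_sym.
Qed.

Lemma pair_energyC (A B : {set V}) : pair_energy A B = pair_energy B A.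
Proof.
have sum_gap C D : \sum_(v in D) gap C v = \sum_(v in D) cost v
    - (\sum_(v in D) #|neighbourhood e v :&: C|)%N%:Z *+ 2.
  by rewrite sumrB sumrMnl -(raddf_sum Posz).
by rewrite /pair_energy !sum_gap sum_neighbourhoodC; lia.
Qed.

Lemma update_thresholdE (U : {set V}) (v : V) : v != v1 ->
  (v \in update e S U) =
  (r v <= #|neighbourhood e v :&: (U :\ v1)|%:Z + (e v v1 && (v1 \in U))%:Z).
Proof.
move=> v_neq; rewrite inE (S_thr v v_neq) inE subsetIl /=.
by rewrite (cardsD1 v1) -setIDA !inE addrC PoszD.
Qed.

Lemma gap_sign (U : {set V}) (v : V) : v != v1 ->
  if v \in update e S U then gap (U :\ v1) v <= 0 else 0 <= gap (U :\ v1) v.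
Proof.
move=> v_neq; rewrite update_thresholdE // /gap /cost.
set d := #|_|; case: (e v v1); case: (v1 \in U) => /=; case: ifP; lia.
Qed.

Lemma gap_eq0 (B : {set V}) (v : V) : gap B v = 0 ->
  e v v1 /\ #|neighbourhood e v :&: B|%:Z = r v - 1.
Proof. by rewrite /gap /cost; case: (e v v1) => /=; [split=> //|]; lia. Qed.

Definition drop (U : {set V}) (v : V) : int :=
  ((v \in U :\ v1)%:Z - (v \in update e S (update e S U) :\ v1)%:Z)
  * gap (update e S U :\ v1) v.

Lemma drop_ge0 (U : {set V}) (v : V) : 0 <= drop U v.
Proof.
rewrite /drop !in_setD1; have [->|v_neq] := eqVneq v v1; first by rewrite mul0r.
have := gap_sign (update e S U) v v_neq.
by case: (v \in U); case: (v \in _) => /=; lia.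
Qed.

Lemma energy_drop (U : {set V}) :
  energy U - energy (update e S U) = \sum_v drop U v.
Proof.
(* After the swap both energies begin with the cost of the middle state, which cancels; the two
   remaining sums share the same [gap]. *)
rewrite /energy pair_energyC /pair_energy opprD addrACA subrr add0r.
rewrite big_mkcond [X in _ - X]big_mkcond -sumrB /=.
apply: eq_bigr => v _; rewrite /drop.
by do 2![case: (v \in _)] => /=; lia.
Qed.

Lemma drop_eventually_eq0 (U0 : {set V}) :
  exists T : nat, forall t : nat, (T <= t)%N -> forall v : V,
    drop (positive_at e S U0 t) v = 0.
Proof.
have energy_noninc U : energy (update e S U) <= energy U.
  by rewrite -subr_ge0 energy_drop sumr_ge0 // => v _; apply: drop_ge0.
have [T T_const] := noninc_iter_eventually_const _ _ energy U0 energy_noninc.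
exists T => t le_Tt v.
have /eqP := energy_drop (positive_at e S U0 t).
rewrite -(T_const t le_Tt) subrr eq_sym => /eqP drop_sum0.
by apply: (psumr_eq0P _ drop_sum0) => // w _; apply: drop_ge0.
Qed.

End Energy.

Theorem theorem1 (V : finType) (e : rel V) (e_sym : symmetric e) (v1 : V)
    (S : V -> {set {set V}}) (S_nbh : rule_families e S)
    (r : V -> int)
    (S_thr : forall v : V, v != v1 -> threshold_rule e S v (r v))
    (U0 : {set V}) :
  let Ustar (t : nat) : {set V} := positive_at e S U0 t :\ v1 in
  exists2 T : nat, (0 < T)%N &
    forall t : nat, (T <= t)%N ->
    forall v : V, v != v1 ->
      v \in set_symdiff (Ustar t.-1) (Ustar t.+1) ->
      v \in neighbourhood e v1 /\
      #|neighbourhood e v :&: Ustar t|%:Z = r v - 1.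
Proof.
move=> Ustar.
have [T T_drop] := drop_eventually_eq0 _ _ e_sym _ _ _ S_thr U0.
(* The drop at time [t] compares times [t] and [t.+2], so it concerns the middle time [t.+1]; hence
   the shift of [T]. *)
exists T.+1 => // -[//|t] le_Tt v _ v_changed.
rewrite inE e_sym; apply: gap_eq0.
have : ((v \in Ustar t)%:Z - (v \in Ustar t.+2)%:Z)
    * gap V e v1 r (Ustar t.+1) v = 0 := T_drop t le_Tt v.
move: v_changed; rewrite inE 2!in_setD /=.
by case: (v \in Ustar t); case: (v \in Ustar t.+2) => //= _; lia.
Qed.
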